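(* $FLO<_c FVS$, i.e. $FLO\le_c FVS$ and $FVS\not\le_c FLO$.
   Context: Conventions: every structure is for a finite relational language and has universe a subset of $\omega$; a class of structures is a collection of structures for one fixed finite relational language closed under isomorphism. $D(\mathcal{A})$ is the atomic diagram of $\mathcal{A}$. A computable transformation from $K$ to $K'$ is a c.e. set $\Phi$ of pairs $(\alpha,\varphi)$, $\alpha$ a finite subset of the atomic diagram of a finite structure in the language of $K$, $\varphi$ an atomic sentence or negation of one in the language of $K'$, such that for every $\mathcal{A}\in K$, $\{\varphi:(\exists\alpha\subseteq D(\mathcal{A}))(\alpha,\varphi)\in\Phi\}=D(\mathcal{B})$ for some $\mathcal{B}\in K'$, written $\Phi(\mathcal{A})=\mathcal{B}$. A computable embedding is a computable transformation with $\mathcal{A}\cong\mathcal{A}'\iff\Phi(\mathcal{A})\cong\Phi(\mathcal{A}')$; $K\le_c K'$ means one exists; $K<_c K'$ means $K\le_c K'$ and $K'\not\le_c K$. $FLO$ is the class of finite linear orders. $FVS$ is the class of finite-dimensional vector spaces over $\mathbb{Q}$, viewed as structures in the finite relational language with unary predicates $V$ (vectors) and $F$ (scalars) and relations representing (as graphs) the field constants $0_F,1_F$, field addition and multiplication, the zero vector, vector addition, and scalar multiplication; the scalar part is a copy of the field $\mathbb{Q}$. *)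

(* Defs.v *)
From HB Require Import structures.
From mathcomp Require Import all_boot all_order all_algebra.
Set Implicit Arguments. Unset Strict Implicit. Unset Printing Implicit Defensive.
Import GRing.Theory Num.Theory.

(* Computability: unlimited-register machines (Minsky/Lambek machines).     *)
(* A program is a list of instructions; pc outside the program = halt.      *)
(* Input is placed in register 0, all other registers 0.                    *)
Inductive instr := Inc of nat & nat | Dec of nat & nat & nat.

Definition step (p : seq instr) (s : nat * seq nat) : option (nat * seq nat) :=
  let: (pc, regs) := s in
  match nth None (map Some p) pc with
  | None => None
  | Some (Inc r j) => Some (j, set_nth 0 regs r (nth 0 regs r).+1)
  | Some (Dec r j k) =>
      if nth 0 regs r is m.+1 then Some (j, set_nth 0 regs r m)
      else Some (k, regs)
  end.

Fixpoint halts_within (p : seq instr) (n : nat) (s : nat * seq nat) : bool :=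
  if n is n'.+1 then
    (if step p s is Some s' then halts_within p n' s' else true)
  else false.

Definition halts (p : seq instr) (x : nat) : Prop :=
  exists n, halts_within p n (0, [:: x]).

(* A predicate on a countable type is c.e. if the set of codes (via the     *)
(* canonical computable coding [pickle]) is the halting set of a machine.   *)
Definition ce (T : countType) (P : T -> Prop) : Prop :=
  exists p : seq instr, forall t : T, P t <-> halts p (pickle t).

(* A language is the list of arities of its relation symbols R_0, R_1, ... *)
Definition language := seq nat.

Record structure := Structure {
  dom : nat -> Prop;
  rel : nat -> seq nat -> Prop
}.

Definition wf_structure (L : language) (A : structure) : Prop :=
  forall i args, rel A i args ->
    [/\ i < size L, size args = nth 0 L i & forall x, x \in args -> dom A x].

Definition finite_structure (A : structure) : Prop :=
  exists s : seq nat, forall x, dom A x <-> x \in s.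

Definition iso (A B : structure) : Prop :=
  exists f : nat -> nat,
    [/\ forall x, dom A x -> dom B (f x),
        forall x y, dom A x -> dom A y -> f x = f y -> x = y,
        forall y, dom B y -> exists2 x, dom A x & f x = y
      & forall i args, (forall x, x \in args -> dom A x) ->
          (rel A i args <-> rel B i (map f args))].

(* Atomic sentences (elements of omega named by constants):                 *)
(*   inl (i, args)  is  R_i(args);   inr (a, b)  is  a = b.                  *)
(* A literal is (b, atom): b = true for the atom, b = false for its negation *)
Notation atom := ((nat * seq nat) + (nat * nat))%type.
Notation literal := (bool * atom)%type.

Definition atom_in_lang (L : language) (t : atom) : bool :=
  match t with
  | inl (i, args) => (i < size L) && (size args == nth 0 L i)
  | inr _ => true
  end.

Definition atom_args (t : atom) : seq nat :=
  match t with inl (_, args) => args | inr (a, b) => [:: a; b] end.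

Definition atom_holds (A : structure) (t : atom) : Prop :=
  match t with inl (i, args) => rel A i args | inr (a, b) => a = b end.

Definition diagram (L : language) (A : structure) (l : literal) : Prop :=
  [/\ atom_in_lang L l.2,
      forall x, x \in atom_args l.2 -> dom A x
    & atom_holds A l.2 <-> l.1 = true].

(* Phi : set of pairs (alpha, phi); a finite set alpha is given as a list.  *)
Definition transf_output (L : language) (Phi : seq literal * literal -> Prop)
    (A : structure) (phi : literal) : Prop :=
  exists alpha : seq literal,
    (forall l, l \in alpha -> diagram L A l) /\ Phi (alpha, phi).

Definition computable_transformation (L : language) (K : structure -> Prop)
    (L' : language) (K' : structure -> Prop)
    (Phi : seq literal * literal -> Prop) : Prop :=
  [/\ ce Phi,
      forall alpha phi, Phi (alpha, phi) ->
        (exists C, [/\ wf_structure L C, finite_structure C &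
                      forall l, l \in alpha -> diagram L C l])
        /\ atom_in_lang L' phi.2
    & forall A, K A -> exists B, K' B /\
        forall phi, transf_output L Phi A phi <-> diagram L' B phi].

Definition computable_embedding (L : language) (K : structure -> Prop)
    (L' : language) (K' : structure -> Prop)
    (Phi : seq literal * literal -> Prop) : Prop :=
  computable_transformation L K L' K' Phi /\
  forall A A' B B', K A -> K A' -> K' B -> K' B' ->
    (forall phi, transf_output L Phi A phi <-> diagram L' B phi) ->
    (forall phi, transf_output L Phi A' phi <-> diagram L' B' phi) ->
    (iso A A' <-> iso B B').

Definition le_c (L : language) (K : structure -> Prop)
    (L' : language) (K' : structure -> Prop) : Prop :=
  exists Phi, computable_embedding L K L' K' Phi.

Definition L_LO : language := [:: 2].

Definition std_LO (n : nat) : structure :=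
  Structure (fun x => x < n)
    (fun i args => i = 0 /\ exists a b, args = [:: a; b] /\ a < b < n).

Definition FLO (A : structure) : Prop :=
  wf_structure L_LO A /\ exists n, iso A (std_LO n).

(* FVS : finite-dimensional Q-vector spaces.  Relation symbols:             *)
(*  0: V (vectors, unary)         1: F (scalars, unary)                     *)
(*  2: 0_F (unary)  3: 1_F (unary)  4: +_F (ternary)  5: *_F (ternary)      *)
(*  6: 0_V (unary)  7: +_V (ternary)  8: scalar mult. (a, v, a v) (ternary) *)
Definition L_VS : language := [:: 1; 1; 1; 1; 3; 3; 1; 3; 3].

Section StdVS.
Variable n : nat.
Local Notation E := ('rV[rat]_n + rat)%type.
Definition vc (v : 'rV[rat]_n) : nat := pickle (inl v : E).
Definition sc (q : rat) : nat := pickle (inr q : E).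

Definition std_VS_rel (i : nat) (args : seq nat) : Prop :=
  match i with
  | 0 => exists v, args = [:: vc v]
  | 1 => exists q, args = [:: sc q]
  | 2 => args = [:: sc 0%R]
  | 3 => args = [:: sc 1%R]
  | 4 => exists a b, args = [:: sc a; sc b; sc (a + b)%R]
  | 5 => exists a b, args = [:: sc a; sc b; sc (a * b)%R]
  | 6 => args = [:: vc 0%R]
  | 7 => exists u v, args = [:: vc u; vc v; vc (u + v)%R]
  | 8 => exists a v, args = [:: sc a; vc v; vc (a *: v)%R]
  | _ => False
  end.

Definition std_VS : structure :=
  Structure (fun x => (exists v, x = vc v) \/ (exists q, x = sc q)) std_VS_rel.
End StdVS.

Definition FVS (A : structure) : Prop :=
  wf_structure L_VS A /\ exists n, iso A (std_VS n).

(* Main.v *)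
(* FLO <= FVS: there is a chain V_0 < V_1 < ... of rational vector spaces, with
   dim V_n = n, whose diagrams are uniformly decidable; sending "A has at least n
   elements" to the diagram of V_n turns an order of size n into V_n.

   FVS </= FLO: a finite set of literals true in a rational vector space is true
   in some copy of any rational vector space of positive dimension, because a
   generic linear map is injective on any given finite set.  The finite diagram
   of the image of V_m is produced by finitely many literals, hence it also
   appears inside the image of a copy of V_n; so for m, n > 0 the images of V_m
   and V_n have the same size and are isomorphic. *)

(* More evidence can only enlarge the output of a transformation, so an element listed late must
   leave all earlier output valid. This is why the spaces of the chain have to be nested as sets of
   naturals. Rows of different lengths are different objects, so elements are taken instead as
   finitely supported rational sequences, whose names do not mention the dimension; choosing the
   least code of each sequence turns equality of elements into equality of naturals. Decidability is
   then a matter of bounded arithmetic on codes, which is brought down to register machines through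
   primitive recursion. In the negative half the target must have positive dimension, since the
   literals V(a), V(b), a != b cannot hold together in the zero space. No linear map into a space of
   smaller dimension is injective; but a finite diagram asks only that finitely many differences
   survive. Pairing with the point (1, t, t^2, ...) of the moment curve achieves this: a difference
   is killed only if t is a root of a nonzero polynomial. *)
From Stdlib Require Import FunctionalExtensionality ClassicalEpsilon.
From HB Require Import structures.
Require Import Defs.
From mathcomp Require Import all_boot all_order all_algebra.
From mathcomp Require Import zify lra.
Set Implicit Arguments. Unset Strict Implicit. Unset Printing Implicit Defensive.
Import GRing.Theory Num.Theory.

(** * Register machines compute the primitive recursive functions *)

Inductive steps (p : seq instr) : nat * seq nat -> nat * seq nat -> Prop :=
| steps_refl s : steps p s s
| steps_step s t u : step p s = Some t -> steps p t u -> steps p s u.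

Lemma steps_trans p s t u : steps p s t -> steps p t u -> steps p s u.
Proof.
elim=> // {}s v w sv _ IH wu; exact: steps_step sv (IH wu).
Qed.

Lemma halts_within_steps p s t : steps p s t ->
  (exists n, halts_within p n s) <-> (exists n, halts_within p n t).
Proof.
elim=> // {}s v w sv _ IH; rewrite -IH; split=> [[[|n]]|[n hn]] //=.
  by rewrite sv => hn; exists n.
by exists n.+1; rewrite /= sv.
Qed.

Definition upd (s : nat -> nat) (x m : nat) : nat -> nat :=
  fun k => if k == x then m else s k.

Lemma upd_nth regs x m : nth 0 (set_nth 0 regs x m) = upd (nth 0 regs) x m.
Proof. by apply: functional_extensionality => k; rewrite nth_set_nth. Qed.

Definition segment (p : seq instr) (pc : nat) (c : seq instr) : Prop :=
  exists pre post, p = pre ++ c ++ post /\ size pre = pc.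

Lemma segment_cat p pc c1 c2 : segment p pc (c1 ++ c2) ->
  segment p pc c1 /\ segment p (pc + size c1) c2.
Proof.
case=> pre [post [-> <-]]; split.
  by exists pre, (c2 ++ post); rewrite -!catA.
by exists (pre ++ c1), post; rewrite size_cat -!catA.
Qed.

Lemma segment_cons p pc i c : segment p pc (i :: c) ->
  nth None (map Some p) pc = Some i /\ segment p pc.+1 c.
Proof.
move=> sg; have [_] := @segment_cat p pc [:: i] c sg.
rewrite addn1; split=> //; case: sg => pre [post [-> <-]].
by rewrite map_cat nth_cat size_map ltnn subnn.
Qed.

(* Jumps are absolute, so the code may depend on its start address [pc], but
   not on the state. *)
Definition realizes (Q : (nat -> nat) -> (nat -> nat) -> Prop) : Prop :=
  forall pc, exists c, forall p, segment p pc c -> forall regs, exists2 regs',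
    steps p (pc, regs) (pc + size c, regs') & Q (nth 0 regs) (nth 0 regs').

Lemma realizes_weaken Q Q' : realizes Q ->
  (forall s s', Q s s' -> Q' s s') -> realizes Q'.
Proof.
move=> rQ QQ' pc; have [c hc] := rQ pc; exists c => p sg regs.
by have [regs' st /QQ'] := hc p sg regs; exists regs'.
Qed.

Lemma realizes_skip : realizes (fun s s' => s' = s).
Proof. by move=> pc; exists [::] => p _ regs; exists regs; rewrite // addn0; constructor. Qed.

Lemma realizes_inc x : realizes (fun s s' => s' = upd s x (s x).+1).
Proof.
move=> pc; exists [:: Inc x pc.+1] => p /segment_cons [hi _] regs.
exists (set_nth 0 regs x (nth 0 regs x).+1); last by rewrite upd_nth.
by apply: steps_step (steps_refl _ _); rewrite /= hi addn1.
Qed.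

Lemma realizes_seq Q1 Q2 : realizes Q1 -> realizes Q2 ->
  realizes (fun s s'' => exists2 s', Q1 s s' & Q2 s' s'').
Proof.
move=> r1 r2 pc; have [c1 h1] := r1 pc; have [c2 h2] := r2 (pc + size c1).
exists (c1 ++ c2) => p /segment_cat [/h1 {}h1 /h2 {}h2] regs.
have [regs1 st1 q1] := h1 regs; have [regs2 st2 q2] := h2 regs1.
exists regs2; last by exists (nth 0 regs1).
by rewrite size_cat addnA; apply: steps_trans st1 st2.
Qed.

Lemma realizes_loop x B R : realizes B ->
  (forall s s', B s s' -> s' x = s x) ->
  (forall s, s x = 0 -> R s s) ->
  (forall s s1 s2 m, s x = m.+1 -> B (upd s x m) s1 -> R s1 s2 -> R s s2) ->
  realizes R.
Proof.
(* There is no unconditional jump, so the test on [x] stands both before and after the body; [e] is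
   the first address past the second test. *)
move=> rB Bx R0 RS pc; have [cb hb] := rB pc.+1; pose e := pc + (size cb).+2.
exists (Dec x pc.+1 e :: cb ++ [:: Dec x pc.+1 e]) => p.
move=> /segment_cons [i1 /segment_cat [/hb {}hb /segment_cons [i2 _]]] regs.
have -> : pc + size (Dec x pc.+1 e :: cb ++ [:: Dec x pc.+1 e]) = e.
  by rewrite /= size_cat /= addn1.
(* The address [q] is kept general because the first round starts at one copy of the test and all
   later rounds at the other. *)
have main m : forall q rs, nth None (map Some p) q = Some (Dec x pc.+1 e) ->
    nth 0 rs x = m -> exists2 rs', steps p (q, rs) (e, rs') & R (nth 0 rs) (nth 0 rs').
  elim: m => [|m IH] q rs iq rx.
    exists rs; last exact: R0.
    by apply: steps_step (steps_refl _ _); rewrite /= iq rx.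
  have [rs1 st1 b1] := hb (set_nth 0 rs x m).
  have [|rs2 st2 r2] := IH _ rs1 i2.
    by rewrite (Bx _ _ b1) upd_nth /upd eqxx.
  exists rs2; last by apply: (RS _ _ _ m _ _ r2); rewrite -?upd_nth.
  apply: steps_step (steps_trans st1 st2).
  by rewrite /= iq rx.
exact: (main _ pc regs i1 erefl).
Qed.

Ltac upd_ext := let k := fresh "k" in
  apply: functional_extensionality => k; rewrite /upd;
  repeat (case: eqVneq => //= ?); subst; lia.

Lemma realizes_zero x : realizes (fun s s' => s' = upd s x 0).
Proof.
apply: (realizes_loop (x := x) realizes_skip) => [s s' -> //|s sx|s s1 s2 m sx -> ->].
  by upd_ext.
by upd_ext.
Qed.

Lemma realizes_addto a b : a != b ->
  realizes (fun s s' => s' = upd (upd s b (s b + s a)) a 0).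
Proof.
move=> ab; apply: (realizes_loop (x := a) (realizes_inc b)).
- by move=> s s' ->; rewrite /upd (negbTE ab).
- by move=> s sa; upd_ext.
move=> s s1 s2 m sa -> ->; rewrite /upd !eqxx (negbTE ab) eq_sym (negbTE ab); upd_ext.
Qed.

(** Reading a register empties it: [a] is drained into [b] and [t] at once and then restored from
    [t]. *)
Lemma realizes_copy a b t : a != b -> a != t -> b != t ->
  realizes (fun s s' => s' b = s a /\ forall k, k != b -> k != t -> s' k = s k).
Proof.
move=> ab aT bt.
have dup : realizes (fun s s' =>
    s' = upd (upd (upd s b (s b + s a)) t (s t + s a)) a 0).
  apply: (realizes_loop (x := a) (realizes_seq (realizes_inc b) (realizes_inc t))).
  - by move=> s s' [s1 -> ->]; rewrite /upd (negbTE ab) (negbTE aT).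
  - by move=> s sa; upd_ext.
  move=> s s1 s2 m sa [s3 -> ->] ->; rewrite /upd !eqxx; upd_ext.
apply: (realizes_weaken (realizes_seq (realizes_zero b) (realizes_seq (realizes_zero t)
  (realizes_seq dup (realizes_addto (_ : t != a)))))); first by rewrite eq_sym.
move=> s s' [s1 -> [s2 -> [s3 -> ->]]]; split=> [|k kb kt].
  rewrite /upd !eqxx; repeat (case: eqVneq => //= ?); subst; lia.
rewrite /upd; repeat (case: eqVneq => //= ?); subst; lia.
Qed.

(* [F] is computed from the registers [ins] into register [base]; everything
   below [base] survives, everything above is scratch space. *)
Definition computable (F : seq nat -> nat) : Prop :=
  forall ins base, all (fun i => i < base) ins ->
  realizes (fun s s' => s' base = F (map s ins) /\ forall k, k < base -> s' k = s k).

Lemma computable_ext F G : (forall e, F e = G e) -> computable F -> computable G.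
Proof.
by move=> /functional_extensionality ->.
Qed.

Lemma computable_var i : computable (fun e => nth 0 e i).
Proof.
move=> ins base hins; case: (ltnP i (size ins)) => hi; last first.
  apply: (realizes_weaken (realizes_zero base)) => s s' ->.
  rewrite nth_default ?size_map // /upd eqxx; split=> // k kb.
  by rewrite ltn_eqF.
have ib : nth 0 ins i < base by apply: (allP hins); apply: mem_nth.
apply: (realizes_weaken (realizes_copy (a := nth 0 ins i) (b := base) (t := base.+1) _ _ _));
  try lia.
move=> s s' [-> h]; rewrite (nth_map 0) //; split=> // k kb.
by apply: h; lia.
Qed.

Lemma computable0 : computable (fun=> 0).
Proof.
move=> ins base hins.
apply: (realizes_weaken (realizes_zero base)) => s s' ->.
by rewrite /upd eqxx; split=> // k kb; rewrite ltn_eqF.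
Qed.

Lemma computableS F : computable F -> computable (fun e => (F e).+1).
Proof.
move=> cF ins base hins.
apply: (realizes_weaken (realizes_seq (cF ins base hins) (realizes_inc base))).
move=> s s' [s1 [h1 h2] ->].
rewrite /upd eqxx h1; split=> // k kb; rewrite ltn_eqF ?h2 //.
Qed.

Lemma all_ltn_trans ins b b' : b <= b' -> all (fun i => i < b) ins -> all (fun i => i < b') ins.
Proof. by move=> bb' /allP h; apply/allP=> i /h; lia. Qed.

Lemma eq_map_below (s s' : nat -> nat) ins b : all (fun i => i < b) ins ->
  (forall k, k < b -> s' k = s k) -> map s' ins = map s ins.
Proof. by move=> /allP h hs; apply/eq_in_map => i /h; apply: hs. Qed.

Lemma computable_rec N F G : computable N -> computable F -> computable G ->
  computable (fun e => nat_rect (fun=> nat) (F e) (fun k acc => G (acc :: k :: e)) (N e)).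
Proof.
move=> cN cF cG ins base hins.
(* Register [base] counts down while the index in [base.+2] counts up and [base.+1] accumulates. The
   loop thus runs the tail-recursive form [it], which [itE] identifies with [nat_rect]. *)
pose it e := fix it n k acc := if n is n'.+1 then it n' k.+1 (G (acc :: k :: e)) else acc.
have itE e f n k : it e n k (nat_rect (fun=> nat) f (fun k acc => G (acc :: k :: e)) k)
                 = nat_rect (fun=> nat) f (fun k acc => G (acc :: k :: e)) (k + n).
  by elim: n k => [|n IH] k /=; rewrite ?addn0 // addnS -addSn -IH.
have hins1 := all_ltn_trans (leqnSn base) hins.
have hG : all (fun i => i < base + 3) (base.+1 :: base.+2 :: ins).
  by rewrite /= !addnS addn0 !ltnS leqnn leqnSn; apply: all_ltn_trans hins; lia.
pose body s s' := [/\ s' (base.+1) = G (s base.+1 :: s base.+2 :: map s ins),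
   s' (base.+2) = (s base.+2).+1 & forall k, k <= base -> s' k = s k].
have rbody : realizes body.
  apply: (realizes_weaken (realizes_seq (cG _ _ hG) (realizes_seq (realizes_copy (a := base + 3)
     (b := base.+1) (t := base + 4) _ _ _) (realizes_inc base.+2)))); try lia.
  move=> s s' [s1 [h1 h2] [s2 [h3 h4] ->]]; rewrite /upd; split.
  - by rewrite ltn_eqF // h3 h1.
  - by rewrite eqxx h4 ?h2; lia.
  - by move=> k kb; rewrite ltn_eqF ?h4 ?h2 //; lia.
pose R s s' := s' base.+1 = it (map s ins) (s base) (s base.+2) (s base.+1) /\
  forall k, k < base -> s' k = s k.
have rR : realizes R.
  apply: (realizes_loop (x := base) rbody).
  - by move=> s s' [_ _ ->].
  - by move=> s s0; split; rewrite ?s0.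
  move=> s s1 s2 m sm [b1 b2 b3] [r1 r2].
  have h k : k < base -> s1 k = s k by move=> kb; rewrite b3 1?ltnW // /upd ltn_eqF.
  split=> [|k kb]; last by rewrite r2 // h.
  rewrite r1 (eq_map_below hins h) b3 // b1 b2 /upd eqxx sm /=.
  rewrite !gtn_eqF //.
  have -> // : [seq (if k == base then m else s k) | k <- ins] = map s ins.
  by apply: (eq_map_below hins) => k kb; rewrite ltn_eqF.
apply: (realizes_weaken (realizes_seq (cN _ _ hins) (realizes_seq (cF _ _ hins1)
  (realizes_seq (realizes_zero base.+2) (realizes_seq rR
  (realizes_copy (a := base.+1) (b := base) (t := base.+2) _ _ _)))))); try lia.
move=> s s' [s1 [h1 h2] [s2 [h3 h4] [s3 -> [s4 [r1 r2] [h5 h6]]]]].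
have h k : k < base -> s2 k = s k by move=> kb; rewrite h4 ?h2 // ltnW.
split=> [|k kb]; last first.
  by rewrite h6 ?r2 // /upd ?ltn_eqF ?h // ; lia.
rewrite h5 r1.
have -> : [seq upd s2 base.+2 0 i | i <- ins] = map s ins.
  by apply: (eq_map_below hins) => k kb; rewrite /upd ltn_eqF ?h //; lia.
rewrite /upd eqxx !ltn_eqF // h3 h4 // h1 (eq_map_below hins h2).
exact: (itE (map s ins) (F (map s ins)) (N (map s ins)) 0).
Qed.

Lemma ce_of_computable (T : countType) (P : T -> Prop) F : computable F ->
  (forall t, P t <-> F [:: pickle t] != 0) -> ce P.
Proof.
move=> cF PF.
have [c hc] := cF [:: 0] 1 isT 0.
(* A nonzero result jumps just past the end of the program, which halts; a zero result enters an
   [Inc] that jumps to itself forever. *)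
pose p := c ++ [:: Dec 1 (size c).+2 (size c).+1; Inc 0 (size c).+1].
exists p => t; rewrite PF /halts; rewrite add0n in hc.
have [|regs' st] := hc p _ [:: pickle t].
  by exists [::], [:: Dec 1 (size c).+2 (size c).+1; Inc 0 (size c).+1].
rewrite /= => -[r1 _]; rewrite (halts_within_steps st) -r1.
have [_] := @segment_cat p 0 c _ (ex_intro _ [::] (ex_intro _ [::] (conj (esym (cats0 p)) erefl))).
rewrite add0n => /segment_cons [i1 /segment_cons [i2 _]].
case E : (nth 0 regs' 1) => [|m]; split=> //.
  case=> [[//|n]] /=; rewrite i1 E.
  elim: n regs' {st r1 E} => [//|n IH] regs' /=; rewrite i2; exact: IH.
move=> _; exists 2; rewrite /= i1 E /= nth_default //.
by rewrite size_map size_cat /= addn2.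
Qed.

(** * Closure properties of the computable functions *)

Lemma computable_behead F : computable F -> computable (fun e => F (behead e)).
Proof.
move=> cF ins base hins; have hb : all (fun i => i < base) (behead ins).
  by case: ins hins => //= a l /andP[].
apply: (realizes_weaken (cF _ _ hb)) => s s' [-> h]; split=> //.
by rewrite behead_map.
Qed.

Lemma computable_behead2 F : computable F -> computable (fun e => F (behead (behead e))).
Proof. by move=> cF; apply: (computable_behead (computable_behead cF)). Qed.

(** Recursion with a curried step: the accumulator and the index are pushed in front of the
    environment, so they are its entries 0 and 1, and the original environment is what remains after
    dropping both. *)
Lemma computable_natrec N F (G : nat -> nat -> seq nat -> nat) :
  computable N -> computable F ->
  computable (fun e => G (nth 0 e 1) (nth 0 e 0) (behead (behead e))) ->
  computable (fun e => nat_rect (fun=> nat) (F e) (fun k acc => G k acc e) (N e)).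
Proof. by move=> cN cF cG; apply: (computable_rec cN cF cG). Qed.

Lemma computable_iter N F (G : nat -> seq nat -> nat) :
  computable N -> computable F ->
  computable (fun e => G (nth 0 e 0) (behead (behead e))) ->
  computable (fun e => iter (N e) (fun acc => G acc e) (F e)).
Proof.
move=> cN cF cG.
apply: (computable_ext _ (computable_natrec (G := fun _ => G) cN cF cG)) => e.
by elim: (N e) => //= n ->.
Qed.

Lemma computable_const n : computable (fun=> n).
Proof. by elim: n => [|n IH]; [apply: computable0 | apply: computableS]. Qed.

Lemma computable_add F G : computable F -> computable G -> computable (fun e => F e + G e).
Proof.
move=> cF cG.
apply: (computable_ext _ (computable_iter (G := fun acc _ => acc.+1) cF cG _)).
  by move=> e; rewrite iter_succn addnC.
exact: computableS (computable_var 0).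
Qed.

Lemma computable_mul F G : computable F -> computable G -> computable (fun e => F e * G e).
Proof.
move=> cF cG.
apply: (computable_ext _ (computable_iter (G := fun acc e => G e + acc) cF computable0 _)).
  by move=> e; rewrite iter_addn addn0 mulnC.
apply: computable_add (computable_var 0).
exact: computable_behead2.
Qed.

Lemma computable_pred F : computable F -> computable (fun e => (F e).-1).
Proof.
move=> cF.
apply: (computable_ext _ (computable_natrec (G := fun k _ _ => k) cF computable0
  (computable_var 1))).
by move=> e; case: (F e).
Qed.

Lemma computable_sub F G : computable F -> computable G -> computable (fun e => F e - G e).
Proof.
move=> cF cG.
apply: (computable_ext _ (computable_iter (G := fun acc _ => acc.-1) cG cF _)).
  by move=> e; rewrite iter_predn.
exact: computable_pred (computable_var 0).
Qed.

Lemma computable_eq0 F : computable F -> computable (fun e => F e == 0).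
Proof.
move=> cF; apply: (computable_ext _ (computable_sub (computable_const 1) cF)) => e.
by case: (F e).
Qed.

Lemma computable_leq F G : computable F -> computable G -> computable (fun e => F e <= G e).
Proof. by move=> cF cG; apply: computable_eq0; apply: computable_sub. Qed.

Lemma computable_negb (P : seq nat -> bool) :
  computable (fun e => P e) -> computable (fun e => ~~ P e).
Proof.
by move=> cP; apply: (computable_ext _ (computable_eq0 cP)) => e; case: (P e).
Qed.

Lemma computable_andb (P Q : seq nat -> bool) :
  computable (fun e => P e) -> computable (fun e => Q e) -> computable (fun e => P e && Q e).
Proof.
move=> cP cQ; apply: (computable_ext _ (computable_mul cP cQ)) => e.
by case: (P e) (Q e) => [] [].
Qed.

Lemma computable_orb (P Q : seq nat -> bool) :
  computable (fun e => P e) -> computable (fun e => Q e) -> computable (fun e => P e || Q e).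
Proof.
move=> cP cQ; apply: (computable_ext _ (computable_negb (computable_andb
  (computable_negb cP) (computable_negb cQ)))) => e.
by case: (P e) (Q e) => [] [].
Qed.

Lemma computable_implyb (P Q : seq nat -> bool) :
  computable (fun e => P e) -> computable (fun e => Q e) -> computable (fun e => P e ==> Q e).
Proof.
move=> cP cQ; apply: (computable_ext _ (computable_orb (computable_negb cP) cQ)) => e.
by case: (P e) (Q e) => [] [].
Qed.

Lemma computable_eqn (F G : seq nat -> nat) :
  computable F -> computable G -> computable (fun e => F e == G e).
Proof.
move=> cF cG; apply: (computable_ext _ (computable_andb (computable_leq cF cG)
  (computable_leq cG cF))) => e.
by rewrite eqn_leq.
Qed.

Lemma computable_eqb (P Q : seq nat -> bool) :
  computable (fun e => P e) -> computable (fun e => Q e) -> computable (fun e => P e == Q e).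
Proof.
move=> cP cQ; apply: (computable_ext _ (computable_eqn cP cQ)) => e.
by case: (P e) (Q e) => [] [].
Qed.

Lemma computable_if (P : seq nat -> bool) F G : computable (fun e => P e) ->
  computable F -> computable G -> computable (fun e => if P e then F e else G e).
Proof.
move=> cP cF cG; apply: (computable_ext _ (computable_add (computable_mul cP cF)
  (computable_mul (computable_negb cP) cG))) => e.
by case: (P e); rewrite /= ?mul1n ?mul0n ?addn0.
Qed.

Lemma computable_ifb (P Q R : seq nat -> bool) : computable (fun e => P e) ->
  computable (fun e => Q e) -> computable (fun e => R e) ->
  computable (fun e => if P e then Q e else R e).
Proof.
move=> cP cF cG; apply: (computable_ext _ (computable_if cP cF cG)) => e.
by case: (P e).
Qed.

Lemma computable_all (P : nat -> seq nat -> bool) N : computable N ->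
  computable (fun e => P (nth 0 e 1) (behead (behead e))) ->
  computable (fun e => all (fun i => P i e) (iota 0 (N e))).
Proof.
move=> cN cP; apply: (computable_ext _ (computable_natrec
  (G := fun k acc e => (acc != 0) && P k e) cN (computable_const 1) _)) => [e|].
  elim: (N e) => // n IH; rewrite -[in RHS]addn1 iotaD all_cat /= IH andbT.
  by case: all.
apply: computable_andb cP; apply: computable_negb; apply: computable_eq0.
exact: computable_var.
Qed.

Create HintDb pr.
#[local] Hint Resolve computable_var computable_const computableS computable_add
  computable_mul computable_pred
  computable_eqn computable_leq computable_negb computable_andb computable_orb computable_implyb
  computable_eqb computable_if computable_ifb computable_all computable_iter
  computable_behead2 : pr.

Lemma computable_odd F : computable F -> computable (fun e => odd (F e)).
Proof.
move=> cF; apply: (computable_ext _ (computable_iter (G := fun acc _ => acc == 0) cF computable0 _))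
  => [e|].
  by elim: (F e) => //= n ->; case: odd.
by auto with pr.
Qed.
#[local] Hint Resolve computable_odd : pr.

Lemma computable_half F : computable F -> computable (fun e => (F e)./2).
Proof.
move=> cF; apply: (computable_ext _ (computable_natrec (G := fun k acc _ => odd k + acc)
  cF computable0 _)) => [e|].
  by elim: (F e) => //= n ->; rewrite uphalf_half.
by auto with pr.
Qed.
#[local] Hint Resolve computable_half : pr.

(** * Decoding [pickle]d data *)

(** [CodeSeq.code (n :: s)] is [2 ^ n * (CodeSeq.code s).*2.+1], so the head is the 2-adic
    valuation. The counter stops growing at the first odd quotient, and [x] rounds are enough to
    reach it; [code_len] counts in the same way. *)
Definition code_hd x := iter x (fun acc => acc + ~~ odd (iter acc half x)) 0.
Definition code_tl x := iter (code_hd x).+1 half x.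
Definition entry x i := code_hd (iter i code_tl x).
Definition code_len x := iter x (fun acc => acc + (0 < iter acc code_tl x)) 0.

Lemma computable_code_hd F : computable F -> computable (fun e => code_hd (F e)).
Proof. by rewrite /code_hd; auto 10 with pr. Qed.
#[local] Hint Resolve computable_code_hd : pr.

Lemma computable_code_tl F : computable F -> computable (fun e => code_tl (F e)).
Proof. by rewrite /code_tl; auto 10 with pr. Qed.
#[local] Hint Resolve computable_code_tl : pr.

Lemma computable_entry F G : computable F -> computable G ->
  computable (fun e => entry (F e) (G e)).
Proof. by rewrite /entry; auto 10 with pr. Qed.
#[local] Hint Resolve computable_entry : pr.

Lemma computable_code_len F : computable F -> computable (fun e => code_len (F e)).
Proof. by rewrite /code_len; auto 10 with pr. Qed.
#[local] Hint Resolve computable_code_len : pr.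

Lemma iter_half k x : iter k half x = x %/ 2 ^ k.
Proof.
by elim: k => [|k IH]; rewrite ?divn1 //= IH -divn2 -divnMA mulnC -expnS.
Qed.

Lemma code_hd_cons n s : code_hd (CodeSeq.code (n :: s)) = n.
Proof.
set x := CodeSeq.code _; have xE : x = 2 ^ n * (CodeSeq.code s).*2.+1 by [].
have odd_x k : k <= n -> odd (iter k half x) = (k == n).
  move=> kn; rewrite iter_half xE -(subnKC kn) expnD -mulnA mulKn ?expn_gt0 //.
  rewrite oddM oddX /= odd_double orbF andbT; lia.
have hd_it j : iter j (fun acc => acc + ~~ odd (iter acc half x)) 0 = minn j n.
  elim: j => [|j IH]; rewrite ?min0n //= IH odd_x ?geq_minr //; lia.
rewrite /code_hd hd_it; apply/minn_idPr.
by rewrite xE (leq_trans (ltnW (ltn_expl n (ltnSn 1)))) // leq_pmulr.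
Qed.

Lemma code_tl_cons n s : code_tl (CodeSeq.code (n :: s)) = CodeSeq.code s.
Proof.
rewrite /code_tl code_hd_cons iter_half /= expnSr divnMA mulKn ?expn_gt0 //.
by rewrite divn2 /= uphalf_double.
Qed.

Lemma iter_code_tl i s : iter i code_tl (CodeSeq.code s) = CodeSeq.code (drop i s).
Proof.
elim: i s => [|i IH] s; first by rewrite drop0.
rewrite iterSr; case: s => [|n s]; rewrite ?code_tl_cons ?IH //=.
by rewrite -[code_tl 0]/(CodeSeq.code [::]) IH.
Qed.

Lemma entry_code s i : entry (CodeSeq.code s) i = nth 0 s i.
Proof.
rewrite /entry iter_code_tl; case: (ltnP i (size s)) => h.
  by rewrite (drop_nth 0) // code_hd_cons.
by rewrite drop_oversize // nth_default.
Qed.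

Lemma size_code s : size s <= CodeSeq.code s.
Proof.
elim: s => //= n s IH; have := expn_gt0 2 n; case: (2 ^ n) => // m _.
by rewrite mulSn; lia.
Qed.

Lemma code_len_code s : code_len (CodeSeq.code s) = size s.
Proof.
have len_it j : iter j (fun acc => acc + (0 < iter acc code_tl (CodeSeq.code s))) 0
    = minn j (size s).
  elim: j => [|j IH]; rewrite ?min0n //= IH iter_code_tl.
  have -> t : (0 < CodeSeq.code t) = (0 < size t).
    by case: t => //= n t; rewrite muln_gt0 expn_gt0.
  by rewrite size_drop subn_gt0; lia.
by rewrite /code_len len_it; apply/minn_idPr/size_code.
Qed.

(** A code is at least as large as the length of its list. Hence the code itself bounds the
    coordinates that a decision procedure has to inspect. *)
Lemma entry_default x i : x <= i -> entry x i = 0.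
Proof.
move=> xi; rewrite -[x]CodeSeq.decodeK entry_code nth_default //.
by apply: leq_trans xi; rewrite -{2}[x]CodeSeq.decodeK size_code.
Qed.

(** * A computable chain of vector spaces *)

(* [s] codes the rational [(entry s 0 - entry s 1) / (entry s 2 + 1)]; the two
   relations below are cross-multiplied so as to live in [nat]. *)
Definition add_code s t u :=
  let a x := entry x 0 in let b x := entry x 1 in let c x := (entry x 2).+1 in
  a s * (c t * c u) + a t * (c s * c u) + b u * (c s * c t) ==
  b s * (c t * c u) + b t * (c s * c u) + a u * (c s * c t).
Definition mul_code s t u :=
  let a x := entry x 0 in let b x := entry x 1 in let c x := (entry x 2).+1 in
  (a s * a t + b s * b t) * c u + b u * (c s * c t) ==
  (a s * b t + b s * a t) * c u + a u * (c s * c t).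

(* An element [x] is a tag followed by rational coordinates; a scalar is kept in
   coordinate [0].  The constants [0] and [2] code the rationals 0 and 1. *)
Definition isvec x := entry x 0 != 0.
Definition coord x i := entry x i.+1.

Definition same_elt x y := (isvec x == isvec y) &&
  all (fun i => add_code (coord x i) 0 (coord y i)) (iota 0 (x + y)).
(** Many codes denote the same sequence of rationals; the least one is its name. The choice does not
    depend on a dimension, so an element keeps its name along the chain. *)
Definition canonical x := all (fun y => ~~ same_elt y x) (iota 0 x).
Definition supported n x :=
  all (fun i => ((if isvec x then n else 1) <= i) ==> add_code 0 0 (coord x i)) (iota 0 x).
Definition in_VS n x := canonical x && supported n x.

Definition rel_code i x y z :=
  if i == 0 then isvec x else
  if i == 1 then ~~ isvec x else
  if i == 2 then ~~ isvec x && add_code 0 0 (coord x 0) else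
  if i == 3 then ~~ isvec x && add_code 0 2 (coord x 0) else
  if i == 4 then [&& ~~ isvec x, ~~ isvec y, ~~ isvec z
                   & add_code (coord x 0) (coord y 0) (coord z 0)] else
  if i == 5 then [&& ~~ isvec x, ~~ isvec y, ~~ isvec z
                   & mul_code (coord x 0) (coord y 0) (coord z 0)] else
  if i == 6 then isvec x && all (fun j => add_code 0 0 (coord x j)) (iota 0 x) else
  if i == 7 then [&& isvec x, isvec y, isvec z
                   & all (fun j => add_code (coord x j) (coord y j) (coord z j))
                         (iota 0 (x + y + z))] else
  if i == 8 then [&& ~~ isvec x, isvec y, isvec z
                   & all (fun j => mul_code (coord x 0) (coord y j) (coord z j))
                         (iota 0 (y + z))] else
  false.
Definition arity_VS i := if [|| i == 4, i == 5, i == 7 | i == 8] then 3 else 1.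

Definition chain_VS n : structure := Structure (in_VS n) (fun i args =>
  [&& i < 9, size args == arity_VS i, all (in_VS n) args
    & rel_code i (nth 0 args 0) (nth 0 args 1) (nth 0 args 2)]).

Definition atom_code_holds i c :=
  rel_code i (entry c 0) (entry c 1) (entry c 2).
Definition rel_diagram_code n i c b :=
  [&& i < 9, code_len c == arity_VS i, all (fun j => in_VS n (entry c j)) (iota 0 (code_len c))
    & atom_code_holds i c == b].
Definition eq_diagram_code n x y b := [&& in_VS n x, in_VS n y & (x == y) == b].
(** A sum is pickled as a pair of lists, one empty (code 0) and one a singleton. The test for 0
    therefore recognises the equality literals. *)
Definition diagram_code n l :=
  if entry (entry l 1) 0 == 0 then
    eq_diagram_code n (entry (entry (entry (entry l 1) 1) 0) 0)
                      (entry (entry (entry (entry l 1) 1) 0) 1) (entry l 0 != 0)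
  else rel_diagram_code n (entry (entry (entry (entry l 1) 0) 0) 0)
                          (entry (entry (entry (entry l 1) 0) 0) 1) (entry l 0 != 0).

Definition refl_lhs l := entry (entry (entry (entry l 1) 1) 0) 0.
Definition is_refl_code l := [&& entry l 0 != 0, entry (entry l 1) 0 == 0
  & refl_lhs l == entry (entry (entry (entry l 1) 1) 0) 1].
Definition increasing_refls a :=
  all (fun i => is_refl_code (entry a i) &&
    ((i.+1 < code_len a) ==> (refl_lhs (entry a i) < refl_lhs (entry a i.+1))))
    (iota 0 (code_len a)).
Definition LO_to_VS_code t :=
  increasing_refls (entry t 0) && diagram_code (code_len (entry t 0)) (entry t 1).

Lemma computable_LO_to_VS_code F : computable F -> computable (fun e => LO_to_VS_code (F e)).
Proof.
have cadd F1 F2 F3 : computable F1 -> computable F2 -> computable F3 ->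
    computable (fun e => add_code (F1 e) (F2 e) (F3 e)).
  by move=> *; apply: computable_eqn; auto 20 with pr.
have cmul F1 F2 F3 : computable F1 -> computable F2 -> computable F3 ->
    computable (fun e => mul_code (F1 e) (F2 e) (F3 e)).
  by move=> *; apply: computable_eqn; auto 20 with pr.
have cvec F1 : computable F1 -> computable (fun e => isvec (F1 e)).
  by rewrite /isvec; auto with pr.
have ccoord F1 F2 : computable F1 -> computable F2 -> computable (fun e => coord (F1 e) (F2 e)).
  by rewrite /coord; auto with pr.
have csame F1 F2 : computable F1 -> computable F2 -> computable (fun e => same_elt (F1 e) (F2 e)).
  by rewrite /same_elt; auto 20 with pr.
have cVS F1 F2 : computable F1 -> computable F2 -> computable (fun e => in_VS (F1 e) (F2 e)).
  by rewrite /in_VS /canonical /supported; auto 20 with pr.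
have crel F1 F2 F3 F4 : computable F1 -> computable F2 -> computable F3 -> computable F4 ->
    computable (fun e => rel_code (F1 e) (F2 e) (F3 e) (F4 e)).
  by rewrite /rel_code; do 9 (intros; apply: computable_ifb; auto 20 with pr).
have cholds F1 F2 : computable F1 -> computable F2 ->
    computable (fun e => atom_code_holds (F1 e) (F2 e)).
  by rewrite /atom_code_holds; auto 20 with pr.
have carity F1 : computable F1 -> computable (fun e => arity_VS (F1 e)).
  by rewrite /arity_VS; auto 20 with pr.
have crd F1 F2 F3 (P : seq nat -> bool) : computable F1 -> computable F2 -> computable F3 ->
    computable P -> computable (fun e => rel_diagram_code (F1 e) (F2 e) (F3 e) (P e)).
  by rewrite /rel_diagram_code; auto 20 with pr.
have ced F1 F2 F3 (P : seq nat -> bool) : computable F1 -> computable F2 -> computable F3 ->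
    computable P -> computable (fun e => eq_diagram_code (F1 e) (F2 e) (F3 e) (P e)).
  by rewrite /eq_diagram_code; auto 20 with pr.
have cd F1 F2 : computable F1 -> computable F2 -> computable (fun e => diagram_code (F1 e) (F2 e)).
  by rewrite /diagram_code; auto 20 with pr.
have clhs F1 : computable F1 -> computable (fun e => refl_lhs (F1 e)).
  by rewrite /refl_lhs; auto 20 with pr.
have crefl F1 : computable F1 -> computable (fun e => is_refl_code (F1 e)).
  by rewrite /is_refl_code; auto 20 with pr.
by rewrite /LO_to_VS_code /increasing_refls; auto 20 with pr.
Qed.

(** * The rationals, vectors and scalars denoted by codes *)

Definition rat_of_code s : rat :=
  (((entry s 0)%:R - (entry s 1)%:R) / (entry s 2).+1%:R)%R.

Lemma rat_of_code0 : rat_of_code 0 = 0%R.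
Proof. by rewrite /rat_of_code !entry_default // subr0 mul0r. Qed.

Lemma rat_of_code2 : rat_of_code 2 = 1%R.
Proof.
by rewrite /rat_of_code -[2]/(CodeSeq.code [:: 1]) !entry_code /= subr0 divr1.
Qed.

Lemma add_codeE s t u :
  add_code s t u = (rat_of_code u == rat_of_code s + rat_of_code t)%R.
Proof.
rewrite /add_code /rat_of_code -(eqr_nat rat) !natrD !natrM.
set c1 := ((entry s 2).+1%:R)%R; set c2 := ((entry t 2).+1%:R)%R; set c3 := ((entry u 2).+1%:R)%R.
have h1 : (c1 != 0)%R by rewrite pnatr_eq0.
have h2 : (c2 != 0)%R by rewrite pnatr_eq0.
have h3 : (c3 != 0)%R by rewrite pnatr_eq0.
rewrite addf_div // eqr_div ?mulf_neq0 //.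
by clearbody c1 c2 c3; apply/eqP/eqP => h; nra.
Qed.

Lemma mul_codeE s t u :
  mul_code s t u = (rat_of_code u == rat_of_code s * rat_of_code t)%R.
Proof.
rewrite /mul_code /rat_of_code -(eqr_nat rat) !(natrD, natrM).
set c1 := ((entry s 2).+1%:R)%R; set c2 := ((entry t 2).+1%:R)%R; set c3 := ((entry u 2).+1%:R)%R.
have h1 : (c1 != 0)%R by rewrite pnatr_eq0.
have h2 : (c2 != 0)%R by rewrite pnatr_eq0.
have h3 : (c3 != 0)%R by rewrite pnatr_eq0.
rewrite mulf_div eqr_div ?mulf_neq0 //.
by clearbody c1 c2 c3; apply/eqP/eqP => h; nra.
Qed.

Lemma rat_of_code_surj q : exists s, rat_of_code s = q.
Proof.
have hq : (0 < `|denq q|)%N by rewrite absz_gt0 denq_neq0.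
have dE : ((`|denq q|.-1).+1%:R = (denq q)%:~R :> rat)%R.
  by rewrite prednK // pmulrn absz_denq.
case: (intP (numq q)) (divq_num_den q) => [|n|n] nE.
- by exists 0; rewrite rat_of_code0 -nE mul0r.
- exists (CodeSeq.code [:: n.+1; 0; `|denq q|.-1]).
  by rewrite /rat_of_code !entry_code /= mulr0n subr0 dE -[RHS]nE.
exists (CodeSeq.code [:: 0; n.+1; `|denq q|.-1]).
by rewrite /rat_of_code !entry_code /= mulr0n sub0r dE -[RHS]nE rmorphN.
Qed.

Lemma coord_default x i : x <= i -> rat_of_code (coord x i) = 0%R.
Proof. by move=> h; rewrite /coord entry_default ?rat_of_code0 // ltnW. Qed.

Lemma all_coordP (P : pred nat) b : (forall i, b <= i -> P i) ->
  reflect (forall i, P i) (all P (iota 0 b)).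
Proof.
move=> hb; apply: (iffP allP) => [h i|h i _ //].
by case: (ltnP i b) => [ib|/hb //]; apply: h; rewrite mem_iota.
Qed.

Lemma same_eltP x y : reflect
  (isvec x = isvec y /\ forall i, rat_of_code (coord x i) = rat_of_code (coord y i))
  (same_elt x y).
Proof.
apply: (iffP andP) => -[].
  move=> /eqP vv /all_coordP h; split=> // i; apply/esym/eqP.
  suff : add_code (coord x i) 0 (coord y i) by rewrite add_codeE rat_of_code0 addr0.
  by apply: h => {}i xy; rewrite add_codeE rat_of_code0 !coord_default ?addr0 //; lia.
move=> -> h; split=> //; apply/allP=> i _.
by rewrite add_codeE rat_of_code0 addr0 h.
Qed.

Lemma supportedP n x : reflect
  (forall i, (if isvec x then n else 1) <= i -> rat_of_code (coord x i) = 0%R)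
  (supported n x).
Proof.
have E i : add_code 0 0 (coord x i) = (rat_of_code (coord x i) == 0)%R.
  by rewrite add_codeE rat_of_code0 addr0.
apply: (iffP (all_coordP _)) => [i xi|h i hi|h i].
- by rewrite E coord_default ?eqxx ?implybT.
- by have := h i; rewrite hi E => /eqP.
by rewrite E; apply/implyP => /h ->.
Qed.

Definition elt n x : 'rV[rat]_n + rat :=
  if isvec x then inl (\row_i rat_of_code (coord x i))%R else inr (rat_of_code (coord x 0)).

Lemma isvec_elt n x : isvec x = if elt n x is inl _ then true else false.
Proof. by rewrite /elt; case: (isvec x). Qed.

Lemma same_elt_sym x y : same_elt x y = same_elt y x.
Proof. by apply/same_eltP/same_eltP => -[-> h]; split=> // i; rewrite h. Qed.

Lemma same_elt_trans x y z : same_elt x y -> same_elt y z -> same_elt x z.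
Proof.
by move=> /same_eltP[v h] /same_eltP[v' h']; apply/same_eltP; split=> [|i]; rewrite ?v ?h.
Qed.

Lemma canonical_inj x y : canonical x -> canonical y -> same_elt x y -> x = y.
Proof.
move=> /allP cx /allP cy xy; case: (ltngtP x y) => // h.
  by have := cy x; rewrite mem_iota h xy => /(_ isT).
by have := cx y; rewrite mem_iota h same_elt_sym xy => /(_ isT).
Qed.

(** The coordinates that [elt n] forgets vanish on both sides by [supported], so the two codes
    denote the same sequence, and canonical codes of one sequence agree. *)
Lemma elt_inj n x y : in_VS n x -> in_VS n y -> elt n x = elt n y -> x = y.
Proof.
move=> /andP[cx /supportedP sx] /andP[cy /supportedP sy] xy.
apply: canonical_inj => //; apply/same_eltP.
have vxy : isvec x = isvec y by rewrite !(isvec_elt n) xy.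
split=> // i; move: xy sx sy; rewrite /elt -vxy; case: (isvec x) => [[xy]|[xy]] sx sy.
  case: (ltnP i n) => [h|h]; last by rewrite sx ?sy.
  by have /rowP/(_ (Ordinal h)) := xy; rewrite !mxE.
by case: i => // i; rewrite sx ?sy.
Qed.

Lemma elt_surj n e : exists2 x, in_VS n x & elt n x = e.
Proof.
have [x0 sx0 ex0] : exists2 x, supported n x & elt n x = e.
  pose code c := CodeSeq.code c.
  case: e => [v|q].
    have /fin_all_exists [c hc] : forall i : 'I_n, exists s, rat_of_code s = v ord0 i.
      by move=> i; apply: rat_of_code_surj.
    pose x := code (1 :: [seq c i | i <- enum 'I_n]).
    have vx : isvec x by rewrite /isvec entry_code.
    exists x.
      apply/supportedP => i; rewrite vx => ni.
      by rewrite /coord entry_code /= nth_default ?rat_of_code0 // size_map size_enum_ord.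
    rewrite /elt vx; congr inl; apply/rowP => i; rewrite mxE /coord entry_code /= -hc.
    by rewrite (nth_map i) ?size_enum_ord // nth_ord_enum.
  have [c hc] := rat_of_code_surj q; pose x := code [:: 0; c].
  have vx : isvec x = false by rewrite /isvec entry_code.
  exists x; last by rewrite /elt vx /coord entry_code /= hc.
  apply/supportedP => i; rewrite vx /coord entry_code; case: i => // i _.
  by rewrite /= nth_nil rat_of_code0.
(* [x0] need not be canonical; the least code with the same tag and coordinates is, and it inherits
   support and value. *)
have [//|x sxx0 minx] := @ex_minnP (same_elt^~ x0).
  by exists x0; apply/same_eltP.
have /same_eltP[vx hx] := sxx0.
exists x; last first.
  by rewrite -ex0 /elt vx hx; case: ifP => // _; congr inl; apply/rowP => i; rewrite !mxE hx.
apply/andP; split.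
  apply/allP=> y; rewrite mem_iota /= add0n => yx; apply/negP => /same_elt_trans /(_ sxx0).
  by move/minx; rewrite leqNgt yx.
by apply/supportedP => i; rewrite vx hx; apply: (supportedP _ _ sx0).
Qed.

(** The relations on the elements themselves, before any naming by naturals: the common reference
    for [std_VS], [chain_VS] and [copy_VS]. *)
Definition vs_rel n (i : nat) (es : seq ('rV[rat]_n + rat)) : bool :=
  match i, es with
  | 0, [:: inl _] => true
  | 1, [:: inr _] => true
  | 2, [:: inr a] => a == 0%R
  | 3, [:: inr a] => a == 1%R
  | 4, [:: inr a; inr b; inr c] => c == (a + b)%R
  | 5, [:: inr a; inr b; inr c] => c == (a * b)%R
  | 6, [:: inl u] => u == 0%R
  | 7, [:: inl u; inl v; inl w] => w == (u + v)%R
  | 8, [:: inr a; inl v; inl w] => w == (a *: v)%R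
  | _, _ => false
  end.

Lemma std_VS_relE n i (es : seq ('rV[rat]_n + rat)) :
  std_VS_rel n i (map pickle es) <-> vs_rel i es.
Proof.
have pI := pcan_inj (@pickleK ('rV[rat]_n + rat)%type).
have mI (l : seq ('rV[rat]_n + rat)) : map pickle es = map pickle l -> es = l.
  exact: inj_map.
split.
  case: i => [|[|[|[|[|[|[|[|[|i]]]]]]]]]; last by [].
  - by case=> v /(mI [:: inl v]) ->.
  - by case=> v /(mI [:: inr v]) ->.
  - by move/(mI [:: inr 0%R]) ->.
  - by move/(mI [:: inr 1%R]) ->.
  - by case=> a [b] /(mI [:: inr a; inr b; inr _]) -> /=.
  - by case=> a [b] /(mI [:: inr a; inr b; inr _]) -> /=.
  - by move/(mI [:: inl 0%R]) ->; apply: eqxx.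
  - by case=> a [b] /(mI [:: inl a; inl b; inl _]) ->; apply: eqxx.
  - by case=> a [b] /(mI [:: inr a; inl b; inl _]) ->; apply: eqxx.
case: i es {mI} => [|[|[|[|[|[|[|[|[|i]]]]]]]]] [|[v|q] [|[v'|q'] [|[v''|q''] [|? ?]]]] h;
  try discriminate h.
- by exists v.
- by exists q.
- by move/eqP: h->.
- by move/eqP: h->.
- by move/eqP: h->; exists q, q'.
- by move/eqP: h->; exists q, q'.
- by move/eqP: h->.
- by move/eqP: h->; exists v, v'.
- by move/eqP: h->; exists q, v'.
Qed.

(** Two cut-offs meet here: coordinates vanish beyond the size of the code, and those of a vector in
    the [n]-th space vanish from [n] on. So the bounded test, the test for all [i] and the test for
    [i < n] agree. *)
Lemma rel_codeE n i args : i < 9 -> size args = arity_VS i -> all (in_VS n) args ->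
  rel_code i (nth 0 args 0) (nth 0 args 1) (nth 0 args 2) = vs_rel i (map (elt n) args).
Proof.
have big x : isvec x -> in_VS n x -> forall i, n <= i -> rat_of_code (coord x i) = 0%R.
  by move=> vx /andP[_ /supportedP]; rewrite vx.
have z s : add_code 0 0 s = (rat_of_code s == 0)%R by rewrite add_codeE rat_of_code0 addr0.
case: i => [|[|[|[|[|[|[|[|[|i]]]]]]]]] // _;
case: args => [|x [|y [|w [|? ?]]]] // _; rewrite /= ?andbT /rel_code /=.
- by rewrite /elt; case: ifP.
- by rewrite /elt; case: ifP.
- by rewrite /elt z; case: ifP.
- by rewrite /elt add_codeE rat_of_code0 rat_of_code2 add0r; case: ifP.
- by rewrite /elt add_codeE; case: (isvec x); case: (isvec y); case: (isvec w).
- by rewrite /elt mul_codeE; case: (isvec x); case: (isvec y); case: (isvec w).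
- rewrite /elt => hx; case: ifP => //= vx; apply/all_coordP/eqP => [i xi|h|h i].
  + by rewrite z coord_default ?eqxx.
  + by apply/rowP => i; rewrite !mxE; apply/eqP; rewrite -z.
  rewrite z; case: (ltnP i n) => hi; last by rewrite (big x).
  by move/rowP/(_ (Ordinal hi)): h; rewrite !mxE /= => ->.
- rewrite /elt => /and3P[hx hy hw]; case: ifP => //= vx; case: ifP => //= vy; case: ifP => //= vw.
  apply/all_coordP/eqP => [i xi|h|h i].
  + by rewrite add_codeE (coord_default (x := x)) ?(coord_default (x := y))
      ?(coord_default (x := w)) ?addr0 //; lia.
  + by apply/rowP => i; rewrite !mxE; apply/eqP; rewrite -add_codeE; apply: h.
  rewrite add_codeE; case: (ltnP i n) => hi; last by rewrite (big x) ?(big y) ?(big w) ?addr0.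
  by move/rowP/(_ (Ordinal hi)): h; rewrite !mxE /= => ->.
rewrite /elt => /and3P[hx hy hw]; case: ifP => //= vx; case: ifP => //= vy; case: ifP => //= vw.
apply/all_coordP/eqP => [i xi|h|h i].
+ by rewrite mul_codeE !(coord_default (x := y)) ?(coord_default (x := w)) ?mulr0 //; lia.
+ by apply/rowP => i; rewrite !mxE; apply/eqP; rewrite -mul_codeE; apply: h.
rewrite mul_codeE; case: (ltnP i n) => hi; last by rewrite (big y) ?(big w) ?mulr0.
by move/rowP/(_ (Ordinal hi)): h; rewrite !mxE /= => ->.
Qed.

Lemma vs_rel_arity n i (es : seq ('rV[rat]_n + rat)) : vs_rel i es ->
  (i < 9) && (size es == arity_VS i).
Proof.
by case: i es => [|[|[|[|[|[|[|[|[|i]]]]]]]]] [|[v|q] [|[v'|q'] [|[v''|q''] [|? ?]]]].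
Qed.

Lemma nth_L_VS i : i < 9 -> nth 0 L_VS i = arity_VS i.
Proof. by case: i => [|[|[|[|[|[|[|[|[|i]]]]]]]]]. Qed.

Lemma dom_std_VS n x : dom (std_VS n) x <-> exists e : 'rV[rat]_n + rat, x = pickle e.
Proof.
split; first by case=> [[v]|[q]] ->; [exists (inl v) | exists (inr q)].
by case=> -[v|q] ->; [left; exists v | right; exists q].
Qed.

Lemma chain_VS_iso n : iso (chain_VS n) (std_VS n).
Proof.
exists (fun x => pickle (elt n x)); split.
- by move=> x _; apply/dom_std_VS; exists (elt n x).
- by move=> x y hx hy /(pcan_inj (@pickleK _)); apply: elt_inj.
- by move=> y /dom_std_VS [e ->]; have [x hx <-] := elt_surj e; exists x.
move=> i args /= hargs.
rewrite (map_comp pickle (elt n)) std_VS_relE.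
have ha : all (in_VS n) args by apply/allP.
split=> [/and4P[hi /eqP hs _]|h]; first by rewrite (rel_codeE hi hs ha).
have /andP[hi] := vs_rel_arity h; rewrite size_map => /eqP hs.
by rewrite hi hs eqxx ha (rel_codeE hi hs ha) h.
Qed.

Lemma chain_VS_FVS n : FVS (chain_VS n).
Proof.
split; last by exists n; apply: chain_VS_iso.
move=> i args /and4P[hi /eqP hs /allP ha _]; split=> //.
by rewrite nth_L_VS.
Qed.

Lemma in_VS_mono n m x : n <= m -> in_VS n x -> in_VS m x.
Proof.
move=> nm /andP[cx /supportedP h]; apply/andP; split=> //.
by apply/supportedP => i hi; apply: h; move: hi; case: ifP => // _; apply: leq_trans.
Qed.

(** Neither [canonical] nor [rel_code] mentions the dimension, so each space is an induced
    substructure of the later ones, and negative literals persist as well. *)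
Lemma diagram_chain_VS_mono n m l : n <= m ->
  diagram L_VS (chain_VS n) l -> diagram L_VS (chain_VS m) l.
Proof.
move=> nm [h1 h2 h3]; split=> // [x /h2|]; first exact: in_VS_mono.
rewrite -h3; case: l h1 h2 {h3} => b [[i args]|[x y]] //= _ ha.
have ha' : all (in_VS n) args by apply/allP.
by rewrite ha' (sub_all _ ha') // => x; apply: in_VS_mono.
Qed.

(** * Codes of literals *)

Lemma pickle_rel_literal (b : bool) i args : pickle ((b, inl (i, args)) : literal) =
  CodeSeq.code [:: nat_of_bool b; CodeSeq.code [:: CodeSeq.code
    [:: CodeSeq.code [:: i; CodeSeq.code args]]; 0]].
(* Pickling a list codes the list of pickles, and [pickle] on [nat] is the identity. *)
Proof. by rewrite -[args in RHS](map_id args); case: b. Qed.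

Lemma pickle_eq_literal (b : bool) x y : pickle ((b, inr (x, y)) : literal) =
  CodeSeq.code [:: nat_of_bool b; CodeSeq.code [:: 0; CodeSeq.code
    [:: CodeSeq.code [:: x; y]]]].
Proof. by case: b. Qed.

Lemma entry_code0 x s : entry (CodeSeq.code (x :: s)) 0 = x.
Proof. by rewrite entry_code. Qed.

Lemma entry_code1 x y s : entry (CodeSeq.code [:: x, y & s]) 1 = y.
Proof. by rewrite entry_code. Qed.

Lemma code_gt0 n s : 0 < CodeSeq.code (n :: s).
Proof. by rewrite muln_gt0 expn_gt0. Qed.

Lemma diagram_codeE n (l : literal) :
  diagram_code n (pickle l) <-> diagram L_VS (chain_VS n) l.
Proof.
have bE (b : bool) : (b != 0 :> nat) = b by case: b.
case: l => b [[i args]|[x y]].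
  rewrite pickle_rel_literal /diagram_code !(entry_code0, entry_code1) (gtn_eqF (code_gt0 _ _)) bE.
  rewrite /rel_diagram_code code_len_code /atom_code_holds !entry_code.
  have -> : all (fun j => in_VS n (entry (CodeSeq.code args) j)) (iota 0 (size args))
      = all (in_VS n) args.
    rewrite -[in RHS](mkseq_nth 0 args) all_map; apply: eq_all => j.
    by rewrite /= entry_code.
  split=> [/and4P[hi /eqP hs ha /eqP hr]|[/= /andP[hi /eqP hs] ha hr]].
    split=> /=; first by rewrite hi nth_L_VS ?hs ?eqxx.
    + by move=> x; apply: (allP ha).
    + by rewrite hi hs eqxx ha hr.
  have {}ha : all (in_VS n) args by apply/allP.
  move: hr; rewrite nth_L_VS // in hs; rewrite hi hs eqxx ha /= => hr.
  by apply/eqP; apply/idP/idP; rewrite hr.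
rewrite pickle_eq_literal /diagram_code !(entry_code0, entry_code1) eqxx bE /eq_diagram_code.
split=> [/and3P[hx hy /eqP hb]|[_ /= h hb]].
  split=> //= [z|]; first by rewrite !inE => /orP[] /eqP->.
  by rewrite -hb; split=> /eqP.
rewrite !h ?inE ?eqxx ?orbT //=; apply/eqP.
by apply/eqP/idP; rewrite hb.
Qed.

(** * Isomorphisms *)

Lemma iso_trans A B C : iso A B -> iso B C -> iso A C.
Proof.
move=> [f [f1 f2 f3 f4]] [g [g1 g2 g3 g4]]; exists (g \o f); split.
- by move=> x /f1/g1.
- by move=> x y hx hy /g2 h; apply: f2 => //; apply: h; apply: f1.
- by move=> z /g3[y /f3[x hx <-] <-]; exists x.
move=> i args ha; have hb y : y \in map f args -> dom B y by case/mapP=> x /ha /f1 ? ->.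
by rewrite map_comp; apply: iff_trans (f4 i args ha) (g4 i _ hb).
Qed.

Lemma iso_sym A B : iso A B -> iso B A.
Proof.
move=> [f [f1 f2 f3 f4]].
have [g hg] : exists g : nat -> nat, forall y, dom B y -> dom A (g y) /\ f (g y) = y.
  exists (fun y => epsilon (inhabits 0) (fun x => dom A x /\ f x = y)) => y /f3[x hx fx].
  by apply: (epsilon_spec (inhabits 0) (fun x => dom A x /\ f x = y)); exists x.
exists g; split.
- by move=> y /hg[].
- by move=> x y /hg[_ hx] /hg[_ hy] e; rewrite -hx e hy.
- by move=> x hx; exists (f x); [apply: f1 | have [h1 h2] := hg _ (f1 _ hx); apply: f2].
move=> i args ha; have hb x : x \in map g args -> dom A x by case/mapP=> y /ha /hg[? _] ->.
have fgK : map f (map g args) = args.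
  by rewrite -map_comp -[RHS]map_id; apply/eq_in_map => y /ha /hg[].
by apply: iff_sym; have := f4 i _ hb; rewrite fgK.
Qed.

(** On vectors the isomorphism is additive and injective. Additivity already gives linearity over
    the rationals, so its matrix has rank [m] and [n] columns. *)
Lemma iso_std_VS_leq m n : iso (std_VS m) (std_VS n) -> m <= n.
Proof.
move=> [f [f1 f2 f3 f4]].
have vdom k (v : 'rV[rat]_k) : dom (std_VS k) (vc v) by left; exists v.
have vcI k : injective (@vc k) by move=> u v /(pcan_inj (@pickleK _)) [].
have hF (v : 'rV[rat]_m) : {w : 'rV[rat]_n | f (vc v) = vc w}.
  apply: constructive_indefinite_description.
  have /(f4 0)[h _] : forall x, x \in [:: vc v] -> dom (std_VS m) x.
    by move=> x; rewrite inE => /eqP->.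
  have [w [hw]] := h (ex_intro _ v erefl).
  by exists w.
pose F v := sval (hF v); have FE v : f (vc v) = vc (F v) := svalP (hF v).
have FD u v : F (u + v)%R = (F u + F v)%R.
  have /(f4 7)[h _] : forall x, x \in [:: vc u; vc v; vc (u + v)%R] -> dom (std_VS m) x.
    by move=> x; rewrite !inE => /or3P[] /eqP->.
  have [a [b e]] := h (ex_intro _ u (ex_intro _ v erefl)).
  move: e; rewrite /map !FE.
  by case=> /vcI-> /vcI-> /vcI.
have FI : injective F.
  by move=> u v e; apply: vcI; apply: f2 => //; rewrite !FE e.
have FB : zmod_morphism F.
  by move=> u v; apply: (addIr (F v)); rewrite -FD !subrK.
pose aM := GRing.isZmodMorphism.Build _ _ F FB.
pose lM := GRing.isScalable.Build _ _ _ _ F (rat_linear FB).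
pose L : {linear 'rV[rat]_m -> 'rV[rat]_n} := HB.pack F aM lM.
rewrite -(_ : \rank (lin1_mx L) = m); first exact: rank_leq_col.
apply/eqP/inj_row_free => v; rewrite mul_rV_lin1 => hv.
by apply: FI; rewrite -[F]/(L : _ -> _) hv raddf0.
Qed.

Lemma iso_std_VS_eq m n : iso (std_VS m) (std_VS n) -> m = n.
Proof.
by move=> h; apply/eqP; rewrite eqn_leq !iso_std_VS_leq //; apply: iso_sym.
Qed.

Lemma iso_size_leq A B s t : (forall x, dom A x <-> x \in s) ->
  (forall x, dom B x <-> x \in t) -> uniq s -> iso A B -> size s <= size t.
Proof.
move=> hs ht us [f [f1 f2 _ _]]; rewrite -(size_map f); apply: uniq_leq_size.
  by rewrite map_inj_in_uniq // => x y /hs hx /hs hy; apply: f2.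
by move=> y /mapP[x /hs /f1 /ht ? ->].
Qed.

(** The list is sorted by the usual order of the naturals, not by the order of [A]: this is the form
    of evidence that [LO_to_VS] accepts. *)
Lemma FLO_enum A : FLO A -> exists s, [/\ sorted ltn s, forall x, dom A x <-> x \in s
  & iso A (std_LO (size s))].
Proof.
case=> _ [n isoA]; have [g [g1 g2 g3 _]] := iso_sym isoA.
pose s := sort leq (map g (iota 0 n)).
have szs : size s = n by rewrite size_sort size_map size_iota.
exists s; split; last by rewrite szs.
  rewrite ltn_sorted_uniq_leq sort_uniq sort_sorted ?andbT; last exact: leq_total.
  rewrite map_inj_in_uniq ?iota_uniq // => x y.
  by rewrite !mem_iota /= !add0n => hx hy; apply: g2.
move=> x; rewrite mem_sort; split=> [/g3[y hy <-]|/mapP[y hy ->]].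
  by apply: map_f; rewrite mem_iota.
by apply: g1; rewrite mem_iota in hy.
Qed.

Lemma iso_std_LO_eq m n : iso (std_LO m) (std_LO n) -> m = n.
Proof.
have dE k x : dom (std_LO k) x <-> x \in iota 0 k by rewrite mem_iota.
move=> h; apply/eqP; rewrite eqn_leq.
have := iso_size_leq (dE m) (dE n) (iota_uniq 0 m) h.
have := iso_size_leq (dE n) (dE m) (iota_uniq 0 n) (iso_sym h).
by rewrite !size_iota => -> ->.
Qed.

(** The identity is an isomorphism: the literal [x = x] records membership in the universe, and
    well-formedness puts every true relation into the diagram. *)
Lemma iso_of_diagram L A B : wf_structure L A -> wf_structure L B ->
  (forall l, diagram L A l <-> diagram L B l) -> iso A B.
Proof.
move=> wA wB AB.
have dAB x : dom A x <-> dom B x.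
  have dE C : dom C x <-> diagram L C (true, inr (x, x)).
    split=> [h|[_ h _]]; last by apply: h; rewrite inE eqxx.
    by split=> // y; rewrite !inE orbb => /eqP->.
  by rewrite !dE.
exists id; split=> //; first by move=> x /dAB.
  by move=> y /dAB hy; exists y.
move=> i args ha; rewrite map_id.
have rE C : wf_structure L C -> Defs.rel C i args <-> diagram L C (true, inl (i, args)).
  move=> wC; split=> [h|[_ _] /=]; last by case=> _; apply.
  by have [h1 h2 h3] := wC _ _ h; split=> //=; rewrite h1 h2 eqxx.
by rewrite !rE.
Qed.

(** * Embedding finite linear orders *)

Definition refl_literal (a : nat) : literal := (true, inr (a, a)).

(** A strictly increasing list has no repetitions, so its length is a lower bound for the number of
    elements of the order. *)
Definition LO_to_VS (t : seq literal * literal) : Prop :=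
  exists s, [/\ sorted ltn s, t.1 = map refl_literal s
    & diagram L_VS (chain_VS (size s)) t.2].

Lemma is_refl_codeE (l : literal) :
  is_refl_code (pickle l) = (l == refl_literal (refl_lhs (pickle l))).
Proof.
rewrite /is_refl_code /refl_lhs; case: l => b [[i args]|[x y]].
  rewrite pickle_rel_literal !(entry_code0, entry_code1) (gtn_eqF (code_gt0 _ _)) andbF.
  by apply/esym/negP => /eqP.
rewrite pickle_eq_literal !(entry_code0, entry_code1) /=.
by apply/andP/eqP => [[hb /eqP<-]|[-> <-]] //; case: b hb.
Qed.

Lemma increasing_reflsE (alpha : seq literal) :
  increasing_refls (CodeSeq.code (map pickle alpha)) <->
  exists2 s, sorted ltn s & alpha = map refl_literal s.
Proof.
rewrite /increasing_refls code_len_code size_map.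
have entryE l i : i < size alpha ->
    entry (CodeSeq.code (map pickle alpha)) i = pickle (nth l alpha i).
  by move=> hi; rewrite entry_code (nth_map l).
split=> [/allP h|[s ss sE]].
  have {}h l i : i < size alpha ->
      nth l alpha i = refl_literal (refl_lhs (pickle (nth l alpha i))) /\
      (i.+1 < size alpha ->
       refl_lhs (pickle (nth l alpha i)) < refl_lhs (pickle (nth l alpha i.+1))).
    move=> hi; have := h i; rewrite mem_iota hi (entryE l) // is_refl_codeE.
    move=> /(_ isT)/andP[/eqP <-]; split=> // hi'.
    by move: b; rewrite hi' /= (entryE l).
  exists (map (fun l => refl_lhs (pickle l)) alpha).
    apply/(sortedP 0) => i; rewrite size_map => hi.
    have l := nth (refl_literal 0) alpha i.
    rewrite !(nth_map l) //; last exact: ltnW.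
    by apply h; rewrite // ltnW.
  rewrite -map_comp -[LHS]map_id; apply/eq_in_map => l /(nthP l)[i hi <-] /=.
  by apply h.
have sz : size alpha = size s by rewrite sE size_map.
have lhsE a : refl_lhs (pickle (refl_literal a)) = a.
  by rewrite /refl_lhs pickle_eq_literal !(entry_code0, entry_code1).
have entE i : i < size s ->
    entry (CodeSeq.code (map pickle alpha)) i = pickle (refl_literal (nth 0 s i)).
  by move=> hi; rewrite (entryE (refl_literal 0)) ?sz // sE (nth_map 0).
apply/allP => i; rewrite mem_iota sz => hi; rewrite entE // is_refl_codeE lhsE eqxx /=.
apply/implyP => hi'; rewrite entE // !lhsE.
by move/(sortedP 0): ss; apply.
Qed.

Lemma LO_to_VS_codeE t : LO_to_VS t <-> LO_to_VS_code (pickle t) != 0 :> nat.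
Proof.
case: t => alpha phi.
have -> : pickle (alpha, phi) = CodeSeq.code [:: CodeSeq.code (map pickle alpha); pickle phi] by [].
rewrite /LO_to_VS_code entry_code0 entry_code1 code_len_code size_map eqb0 negbK.
split=> [[s [ss /= sE hd]]|/andP[/increasing_reflsE[s ss sE] /diagram_codeE hd]].
  apply/andP; split; first by apply/increasing_reflsE; exists s.
  by apply/diagram_codeE; rewrite sE size_map.
by exists s; split=> //=; move: hd; rewrite sE size_map.
Qed.

(** Evidence that lists only part of [A] yields the diagram of a smaller space of the chain, which
    lies inside that of the full one; listing all of [s] yields the rest. *)
Lemma LO_to_VS_output A s phi : sorted ltn s -> (forall x, dom A x <-> x \in s) ->
  transf_output L_LO LO_to_VS A phi <-> diagram L_VS (chain_VS (size s)) phi.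
Proof.
move=> ss hs; have us r : sorted ltn r -> uniq r by rewrite ltn_sorted_uniq_leq => /andP[].
split=> [[alpha [hal [r [/us ur /= rE hd]]]]|hd].
  apply: (diagram_chain_VS_mono _ hd); apply: uniq_leq_size => // x xr; apply/hs.
  have [|_ h _] := hal (refl_literal x); first by rewrite rE map_f.
  by apply: h; rewrite inE eqxx.
exists (map refl_literal s); split; last by exists s.
move=> l /mapP[x xs ->]; split=> //= y; rewrite !inE orbb => /eqP->; exact/hs.
Qed.

Lemma FLO_le_FVS : le_c L_LO FLO L_VS FVS.
Proof.
exists LO_to_VS; split; first split.
- apply: (ce_of_computable (computable_LO_to_VS_code (computable_var 0))) => t.
  exact: LO_to_VS_codeE.
- move=> alpha phi [s [_ /= -> [hl _ _]]]; split=> //.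
  exists (Structure (fun x => x \in s) (fun _ _ => False)); split=> //; first by exists s.
  by move=> l /mapP[x xs ->]; split=> //= y; rewrite !inE orbb => /eqP->.
- move=> A /FLO_enum[s [ss hs _]]; exists (chain_VS (size s)).
  by split=> [|phi]; [apply: chain_VS_FVS | apply: LO_to_VS_output].
move=> A A' B B' /FLO_enum[s [ss hs isoA]] /FLO_enum[s' [ss' hs' isoA']] hB hB' oB oB'.
have isoB r C D : FVS D -> sorted ltn r -> (forall x, dom C x <-> x \in r) ->
    (forall phi, transf_output L_LO LO_to_VS C phi <-> diagram L_VS D phi) ->
    iso D (std_VS (size r)).
  move=> [wD _] sr hr oD; apply: iso_trans (chain_VS_iso _).
  apply: (@iso_of_diagram L_VS) => // [|l]; first by case: (chain_VS_FVS (size r)).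
  exact: iff_trans (iff_sym (oD l)) (LO_to_VS_output _ sr hr).
have {}oB := isoB s A B hB ss hs oB; have {isoB}oB' := isoB s' A' B' hB' ss' hs' oB'.
split=> h.
  have e : size s = size s'.
    by apply: iso_std_LO_eq; apply: iso_trans (iso_sym isoA) (iso_trans h isoA').
  by rewrite -e in oB'; apply: iso_trans oB (iso_sym oB').
have e : size s = size s'.
  by apply: iso_std_VS_eq; apply: iso_trans (iso_sym oB) (iso_trans h oB').
by rewrite -e in isoA'; apply: iso_trans isoA (iso_sym isoA').
Qed.

(** * Vector spaces do not embed *)

(** The naming [h] is left free so that literals mentioning prescribed naturals can be made true in
    a space of another dimension. *)
Definition copy_VS n (h : 'rV[rat]_n + rat -> nat) : structure :=
  Structure (fun x => exists e, x = h e)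
            (fun i args => exists2 es, args = map h es & vs_rel i es).

Lemma map_image (T : Type) (h : T -> nat) (s : seq nat) :
  (forall x, x \in s -> exists e, x = h e) -> exists es, s = map h es.
Proof.
elim: s => [|x s IH] hs; first by exists [::].
have [e ->] := hs x (mem_head x s).
have [|es ->] := IH; first by move=> y ys; apply: hs; rewrite inE ys orbT.
by exists (e :: es).
Qed.

Lemma copy_VS_iso n (h : 'rV[rat]_n + rat -> nat) : injective h -> iso (std_VS n) (copy_VS h).
Proof.
move=> hI; pose f x := if unpickle x is Some e then h e else 0.
have fE e : f (pickle e) = h e by rewrite /f pickleK.
exists f; split.
- by move=> x /dom_std_VS[e ->]; exists e; apply: fE.
- by move=> x y /dom_std_VS[e ->] /dom_std_VS[e' ->]; rewrite !fE => /hI->.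
- by move=> y [e ->]; exists (pickle e); [apply/dom_std_VS; exists e | apply: fE].
move=> i args ha.
have [|es ->] := @map_image ('rV[rat]_n + rat)%type pickle args.
  by move=> x /ha /dom_std_VS.
rewrite -map_comp (eq_map fE); apply: (iff_trans (std_VS_relE _ _)).
split=> [he|[es' /(inj_map hI) -> //]].
by exists es.
Qed.

Lemma copy_VS_FVS n (h : 'rV[rat]_n + rat -> nat) : injective h -> FVS (copy_VS h).
Proof.
move=> hI; split; last by exists n; apply: iso_sym; apply: copy_VS_iso.
move=> i args [es -> /vs_rel_arity /andP[hi /eqP hs]]; split=> //.
  by rewrite size_map nth_L_VS.
by move=> x /mapP[e _ ->]; exists e.
Qed.

(** * Generic linear maps: finitely many conditions met by one large parameter *)

Definition eventually (P : nat -> Prop) : Prop := exists N, forall t, N <= t -> P t.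

Lemma eventually_and P Q : eventually P -> eventually Q -> eventually (fun t => P t /\ Q t).
Proof.
move=> [N hN] [M hM]; exists (maxn N M) => t; rewrite geq_max => /andP[Nt Mt].
by split; [apply: hN | apply: hM].
Qed.

Lemma eventually_sub (P Q : nat -> Prop) : (forall t, P t -> Q t) -> eventually P -> eventually Q.
Proof. by move=> PQ [N hN]; exists N => t /hN/PQ. Qed.

Lemma eventually_all (T : eqType) (s : seq T) (P : T -> nat -> Prop) :
  (forall x, x \in s -> eventually (P x)) -> eventually (fun t => forall x, x \in s -> P x t).
Proof.
elim: s => [|x s IH] hs; first by exists 0.
have /IH {}IH : forall y, y \in s -> eventually (P y).
  by move=> y ys; apply: hs; rewrite inE ys orbT.
apply: eventually_sub (eventually_and (hs x (mem_head x s)) IH) => t [hx h] y.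
by rewrite inE => /orP[/eqP->|/h].
Qed.

(** Induction on the size: a natural root [t0] is divided out, and its linear factor is nonzero from
    [t0.+1] on. *)
Lemma eventually_horner_neq0 (p : {poly rat}) : p != 0%R -> eventually (fun t => p.[t%:R] != 0)%R.
Proof.
move: {2}(size p) (leqnn (size p)) => n; elim: n p => [|n IH] p.
  by rewrite leqn0 size_poly_eq0 => ->.
move=> szp p0; case: (classic (exists t : nat, root p t%:R)%R)
  => [[t0 /factor_theorem[q pE]]|noroot].
  have q0 : (q != 0)%R by apply: contraNneq p0 => q0; rewrite pE q0 mul0r.
  have szq : size q <= n.
    by move: szp; rewrite pE size_Mmonic ?monicXsubC // size_XsubC addn2.
  have [N hN] := IH q szq q0; exists (maxn N t0.+1) => t; rewrite geq_max => /andP[/hN qt tt].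
  rewrite pE hornerM mulf_neq0 // hornerXsubC subr_eq0 eqr_nat; lia.
by exists 0 => t _; apply/negP => pt; apply: noroot; exists t.
Qed.

(* Generic linear maps into a space of any positive dimension: for a fixed
   finite set of vectors and all large [t], no nonzero one is killed. *)
Definition moment_map m n (t : nat) (z : 'rV[rat]_m) : 'rV[rat]_n.+1 :=
  const_mx (rVpoly z).[t%:R]%R.

Lemma moment_mapD m n t : {morph @moment_map m n t : u v / (u + v)%R}.
Proof. by move=> u v; apply/rowP => i; rewrite !mxE linearD hornerD. Qed.

Lemma moment_mapZ m n t a (v : 'rV[rat]_m) :
  moment_map n t (a *: v)%R = (a *: moment_map n t v)%R.
Proof. by apply/rowP => i; rewrite !mxE linearZ hornerZ. Qed.

Lemma moment_map0 m n t : @moment_map m n t 0%R = 0%R.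
Proof. by apply/rowP => i; rewrite !mxE linear0 horner0. Qed.

Lemma moment_mapN m n t (v : 'rV[rat]_m) : moment_map n t (- v)%R = (- moment_map n t v)%R.
Proof. by apply/rowP => i; rewrite !mxE linearN hornerN. Qed.

(** The row [u - v], read as the coefficients of a polynomial, has a nonzero value at every large
    [t]. One coordinate of the target detects this, whence the dimension [n.+1]. *)
Lemma eventually_moment_map m n (u v : 'rV[rat]_m) :
  eventually (fun t => moment_map n t u = moment_map n t v -> u = v).
Proof.
have [->|uv] := eqVneq u v; first by exists 0.
have /eventually_horner_neq0 [N hN] : rVpoly (u - v)%R != 0%R.
  apply: contra_neq uv => h; apply/eqP; rewrite -subr_eq0 -[(u - v)%R]rVpolyK h.
  by rewrite linear0.
exists N => t /hN /eqP h uvt; case: h.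
have /rowP/(_ ord0) : moment_map n t (u - v)%R = 0%R.
  by rewrite moment_mapD moment_mapN uvt subrr.
by rewrite !mxE.
Qed.

Definition moment_elt m n t (e : 'rV[rat]_m + rat) : 'rV[rat]_n.+1 + rat :=
  match e with inl v => inl (moment_map n t v) | inr q => inr q end.

Lemma eventually_moment_elt m n (x y : 'rV[rat]_m + rat) :
  eventually (fun t => moment_elt n t x = moment_elt n t y -> x = y).
Proof.
case: x y => [u|a] [v|b]; [|by exists 0|by exists 0|by exists 0 => t _ []->].
by apply: eventually_sub (eventually_moment_map n u v) => t h [/h ->].
Qed.

(** Linearity preserves a true relation. To preserve a false one, the map must also separate a
    listed vector from the sum, multiple or zero it is compared with, which need not be listed. *)
Lemma eventually_vs_rel m n i (es : seq ('rV[rat]_m + rat)) :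
  eventually (fun t => vs_rel i (map (moment_elt n t) es) = vs_rel i es).
Proof.
have lin (u v : 'rV[rat]_m) (w : nat -> 'rV_n.+1) : (forall t, w t = moment_map n t v) ->
    eventually (fun t => (moment_map n t u == w t) = (u == v)).
  move=> wE; apply: eventually_sub (eventually_moment_map n u v) => t h.
  by rewrite wE; apply/eqP/eqP => [/h|->].
case: i es => [|[|[|[|[|[|[|[|[|i]]]]]]]]] [|[v|q] [|[v'|q'] [|[v''|q''] [|? ?]]]];
  try by exists 0.
- by apply: lin => t; rewrite moment_map0.
- by apply: lin => t; rewrite moment_mapD.
- by apply: lin => t; rewrite moment_mapZ.
Qed.

(** * Transfer of finite diagrams between dimensions *)

Lemma realize_in_dim m n (alpha : seq literal) :
  (forall l, l \in alpha ->
     diagram L_VS (copy_VS (pickle : 'rV[rat]_m + rat -> nat)) l) ->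
  exists A, [/\ FVS A, iso A (std_VS n.+1) & forall l, l \in alpha -> diagram L_VS A l].
Proof.
move=> halpha.
pose elts (l : literal) : seq ('rV[rat]_m + rat) := pmap unpickle (atom_args l.2).
have eltsE l : l \in alpha -> atom_args l.2 = map pickle (elts l).
  move=> /halpha[_ /map_image[es hes] _]; rewrite /elts hes; congr map.
  by rewrite (map_pK (@pickleK _)).
pose X := flatten (map elts alpha).
(* All nine symbols are treated for every literal, because an equality literal carries no symbol of
   its own. *)
have [t0 ev] : eventually (fun t =>
    (forall x, x \in X -> forall y, y \in X -> moment_elt n t x = moment_elt n t y -> x = y) /\
    (forall l, l \in alpha -> forall i, i \in iota 0 9 ->
       vs_rel i (map (moment_elt n t) (elts l)) = vs_rel i (elts l))).
  apply: eventually_and; apply: eventually_all => x _; apply: eventually_all => y _.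
    exact: eventually_moment_elt.
  exact: eventually_vs_rel.
have {ev} [FI Frel] := ev t0 (leqnn t0); set F := moment_elt n t0 in FI Frel.
(* [M] exceeds every name used for [X]. The image of an element of [X] takes over that element's old
   name, and all other elements are named from [M] on, so [h] is injective. *)
pose M := (\sum_(x <- X) pickle x).+1.
have XM x : x \in X -> pickle x < M.
  by move=> xX; rewrite ltnS (big_rem x) //= leq_addr.
pose h y := if [seq x <- X | F x == y] is x :: _ then pickle x else M + pickle y.
have hP y : (exists x, [/\ x \in X, F x = y & h y = pickle x]) \/ h y = M + pickle y.
  rewrite /h; case E : [seq x <- X | F x == y] => [|x s]; [by right | left; exists x].
  have : x \in [seq x <- X | F x == y] by rewrite E mem_head.
  by rewrite mem_filter => /andP[/eqP].
have hF x : x \in X -> h (F x) = pickle x.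
  move=> xX; rewrite /h; case E : [seq x' <- X | F x' == F x] => [|x' s].
    by have := mem_filter (fun x' => F x' == F x) x X; rewrite E eqxx xX.
  have : x' \in [seq x' <- X | F x' == F x] by rewrite E mem_head.
  by rewrite mem_filter => /andP[/eqP e x'X]; rewrite (FI _ x'X _ xX e).
have hI : injective h.
  move=> y y'; case: (hP y) (hP y') => [[x [xX <- ->]]|->] [[x' [x'X <- ->]]|->].
  - by move/(pcan_inj (@pickleK _)) ->.
  - by have := XM x xX; lia.
  - by have := XM x' x'X; lia.
  - by move/addnI/(pcan_inj (@pickleK _)).
exists (copy_VS h); split; first exact: copy_VS_FVS.
  by apply: iso_sym; apply: copy_VS_iso.
move=> l lalpha; have [h1 h2 h3] := halpha l lalpha.
have lX x : x \in elts l -> x \in X.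
  by move=> xl; apply/flatten_mapP; exists l.
have argsE : atom_args l.2 = map h (map F (elts l)).
  rewrite eltsE // -map_comp; apply/eq_in_map => x /lX xX.
  by rewrite /= hF.
split=> //.
  by move=> x; rewrite argsE => /mapP[y _ ->]; exists y.
rewrite -h3; case: l lalpha argsE h1 {h2 h3 lX} => b [[i args]|[x y]] //= la argsE /andP[hi _].
have argsE' := eltsE _ la; rewrite /= in argsE'.
have Fi := Frel _ la i; rewrite mem_iota /= in Fi.
set es := elts _ in argsE argsE' Fi.
have pI := pcan_inj (@pickleK ('rV[rat]_m + rat)%type).
split=> -[es' e' he'].
  exists es => //; rewrite -Fi //.
  by rewrite argsE in e'; rewrite (inj_map hI e').
exists (map F es) => //; rewrite Fi //.
by rewrite argsE' in e'; rewrite (inj_map pI e').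
Qed.

(** The universe of the image is finite, so the evidence for all its literals [x = x] can be pooled
    into one finite list; any structure satisfying that list has these elements in its image too. *)
Lemma collect_evidence Phi A B (s : seq nat) : (forall x, dom B x <-> x \in s) ->
  (forall phi, transf_output L_VS Phi A phi <-> diagram L_LO B phi) ->
  exists alpha : seq literal, (forall l, l \in alpha -> diagram L_VS A l) /\
    forall A', (forall l, l \in alpha -> diagram L_VS A' l) ->
    forall x, x \in s -> transf_output L_VS Phi A' (true, inr (x, x)).
Proof.
move=> hs oB; have {hs oB} : forall x, x \in s -> transf_output L_VS Phi A (true, inr (x, x)).
  move=> x /hs xB; apply/oB; split=> // y.
  by rewrite !inE orbb => /eqP->.
elim: s => [|x s IH] hs; first by exists [::].
have [|alpha [h1 h2]] := IH; first by move=> y ys; apply: hs; rewrite inE ys orbT.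
have [beta [b1 b2]] := hs x (mem_head x s).
exists (beta ++ alpha); split=> [l|A' hA' y].
  by rewrite mem_cat => /orP[/b1|/h1].
rewrite inE => /orP[/eqP->|ys].
  by exists beta; split=> // l lb; apply: hA'; rewrite mem_cat lb.
by apply: h2 => // l la; apply: hA'; rewrite mem_cat la orbT.
Qed.

(** The pooled evidence also holds in some copy [A] of [A']. The image of [A] contains the universe
    of [B], and it is isomorphic to [B'] because [Phi] respects isomorphism. *)
Lemma output_size_leq Phi m n A' B B' (s s' : seq nat) :
  computable_embedding L_VS FVS L_LO FLO Phi ->
  (forall phi, transf_output L_VS Phi (copy_VS (pickle : 'rV[rat]_m + rat -> nat)) phi
     <-> diagram L_LO B phi) ->
  FVS A' -> iso A' (std_VS n.+1) -> FLO B' ->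
  (forall phi, transf_output L_VS Phi A' phi <-> diagram L_LO B' phi) ->
  uniq s -> (forall x, dom B x <-> x \in s) ->
  (forall x, dom B' x <-> x \in s') -> size s <= size s'.
Proof.
move=> [[_ _ PhiFLO] Phi_iso] oB vA' isoA' loB' oB' us hs hs'.
have [alpha [ha evid]] := collect_evidence hs oB.
have [A [vA isoA hA]] := realize_in_dim n ha.
have [C [loC oC]] := PhiFLO A vA.
have isoC : iso C B'.
  apply/(Phi_iso A A' C B') => //.
  exact: iso_trans isoA (iso_sym isoA').
have [r [sr hr _]] := FLO_enum loC.
apply: (@leq_trans (size r)).
  apply: uniq_leq_size => // x xs; apply/hr.
  by have /oC[_ h _] := evid A hA x xs; apply: h; rewrite inE eqxx.
by apply: iso_size_leq hr hs' _ isoC; move: sr; rewrite ltn_sorted_uniq_leq => /andP[].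
Qed.

Lemma FVS_not_le_FLO : ~ le_c L_VS FVS L_LO FLO.
Proof.
move=> [Phi embPhi]; have [[_ _ PhiFLO] Phi_iso] := embPhi.
pose V n := copy_VS (pickle : 'rV[rat]_n + rat -> nat).
have pI n : injective (pickle : 'rV[rat]_n + rat -> nat) := pcan_inj (@pickleK _).
have isoV n : iso (V n) (std_VS n) := iso_sym (copy_VS_iso (@pI n)).
have vV n : FVS (V n) := copy_VS_FVS (@pI n).
(* Any two distinct positive dimensions would do; positivity lets the size comparison run in both
   directions. *)
have [B1 [lo1 o1]] := PhiFLO _ (vV 1); have [B2 [lo2 o2]] := PhiFLO _ (vV 2).
have [s1 [ss1 hs1 iso1]] := FLO_enum lo1; have [s2 [ss2 hs2 iso2]] := FLO_enum lo2.
have us s : sorted ltn s -> uniq s by rewrite ltn_sorted_uniq_leq => /andP[].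
have s12 : size s1 = size s2.
  apply/eqP; rewrite eqn_leq.
  rewrite (output_size_leq embPhi o1 (vV 2) (isoV 2) lo2 o2 (us _ ss1) hs1 hs2).
  by rewrite (output_size_leq embPhi o2 (vV 1) (isoV 1) lo1 o1 (us _ ss2) hs2 hs1).
have /(Phi_iso _ _ _ _ (vV 1) (vV 2) lo1 lo2 o1 o2) iso12 : iso B1 B2.
  by rewrite -s12 in iso2; apply: iso_trans iso1 (iso_sym iso2).
by have := iso_std_VS_eq (iso_trans (iso_sym (isoV 1)) (iso_trans iso12 (isoV 2))).
Qed.

Theorem theorem2p6 :
  le_c L_LO FLO L_VS FVS /\ ~ le_c L_VS FVS L_LO FLO.
Proof.
by split; [apply: FLO_le_FVS | apply: FVS_not_le_FLO].
Qed.
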